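(* Consider the generalized surface code of a tiling $(V,E,F)$ of a surface with boundary, with non-open vertex set $\mathring{V}$ and non-open edge set $\mathring{E}$, $n=|\mathring{E}|$, edges in $\mathring{E}$ being identified with $\{1,\dots,n\}$. Let $I\subseteq\mathring{E}$ be a set of erased qubits and $\overline{I}=\mathring{E}\setminus I$. Let $\mathring{V}_{\overline{I}}=\{v\in\mathring{V}:\text{there is no }e\in I\text{ with }v\in e\}$ and $F_{\overline{I}}=\{f\in F:\text{there is no }e\in I\text{ with }e\in f\}$. For $v\in\mathring{V}$ let $\vec{v}\in\mathbf{F}_2^n$ be the vector whose component at $e\in\mathring{E}$ is $1$ if $v\in e$ and $0$ otherwise; for $f\in F$ let $\vec{f}\in\mathbf{F}_2^n$ be the vector whose component at $e\in\mathring{E}$ is $1$ if $e\in f$ and $0$ otherwise. Let $C_X$ be the linear code generated by $\{\vec{f}:f\in F\}$ and $C_Z$ the linear code generated by $\{\vec{v}:v\in\mathring{V}\}$. Then: 1. The linear space generated by $\{\vec{f}:f\in F_{\overline{I}}\}$ is contained in $C_X\cap\mathbf{F}_2^{\overline{I}}$, and that generated by $\{\vec{v}:v\in\mathring{V}_{\overline{I}}\}$ is contained in $C_Z\cap\mathbf{F}_2^{\overline{I}}$. 2. With $D_X$ the linear space generated by $\{\vec{f}:f\in F\setminus F_{\overline{I}}\}$ and $D_Z$ the linear space generated by $\{\vec{v}:v\in\mathring{V}\setminus\mathring{V}_{\overline{I}}\}$, one has $C_X=D_X+(C_X\cap\mathbf{F}_2^{\overline{I}})$ and $C_Z=D_Z+(C_Z\cap\mathbf{F}_2^{\overline{I}})$.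 3. If the code can correct erasures at $I$, then the $X$ erasures at $I$ can be identified by $|F\setminus F_{\overline{I}}|$ measurements (of $Z_f$, $f\in F\setminus F_{\overline{I}}$) of the $\left|\mathring{E}\cap\bigcup_{f\in F\setminus F_{\overline{I}}}f\right|$ qubits in $\mathring{E}\cap\bigcup_{f\in F\setminus F_{\overline{I}}}f$, and the $Z$ erasures at $I$ can be identified by $|\mathring{V}\setminus\mathring{V}_{\overline{I}}|$ measurements (of $X_v$, $v\in\mathring{V}\setminus\mathring{V}_{\overline{I}}$) of the $\left|\{e\in\mathring{E}:\exists v\in\mathring{V}\setminus\mathring{V}_{\overline{I}},\ v\in e\}\right|$ qubits in that set.
   Context: Generalized surface code. $(V,E,F)$ is a finite tiling of a topological surface, possibly with boundary: $V$ is the vertex set; an edge $e=\{u,v\}\in E$ connects two vertices $u,v$; a face $f\in F\subseteq 2^E$ is identified with the set of edges of the cycle surrounding it. Every edge lies in one or two faces. An edge $e$ is boundary if it lies in exactly one face; a vertex is boundary if it belongs to a boundary edge. Each boundary edge is arbitrarily declared open or closed; a boundary vertex is open if it belongs to an open boundary edge, and closed otherwise. $\mathring{V}$ (resp. $\mathring{E}$) is the set of non-boundary or closed boundary vertices (resp. edges). The code has one qubit for each $e\in\mathring{E}$, and its stabilizer group is generated by $X_v=\bigotimes_{e\in\mathring{E},\,v\in e}X_e$ for $v\in\mathring{V}$ and $Z_f=\bigotimes_{e\in f\cap\mathring{E}}Z_e$ for $f\in F$, where $X_e,Z_e$ are the Pauli matrices on qubit $e$; these generators commute. $\mathbf{F}_2^{J}=\{(a_e)\in\mathbf{F}_2^n:a_e=0\text{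 if }e\notin J\}$ for $J\subseteq\mathring{E}$; $C^{\perp e}$ is the Euclidean dual in $\mathbf{F}_2^n$. The code can correct erasures at $I$ if and only if $C_Z\cap\mathbf{F}_2^I=C_X^{\perp e}\cap\mathbf{F}_2^I$ and $C_X\cap\mathbf{F}_2^I=C_Z^{\perp e}\cap\mathbf{F}_2^I$. An $X$ erasure at $I$ is an error $\bigotimes_e X_e^{a_e}$ with $\vec{a}\in\mathbf{F}_2^I$; measuring $Z_f$ yields $\vec{f}\cdot\vec{a}\in\mathbf{F}_2$. The $X$ erasures at $I$ are identified by measuring $Z_f$ for $f$ in a set $F'$ if the values $(\vec{f}\cdot\vec{a})_{f\in F'}$ determine $\vec{a}\in\mathbf{F}_2^I$ uniquely modulo $C_Z$. Likewise a $Z$ erasure is $\bigotimes_e Z_e^{b_e}$ with $\vec{b}\in\mathbf{F}_2^I$, measuring $X_v$ yields $\vec{v}\cdot\vec{b}$, and the $Z$ erasures at $I$ are identified by measuring $X_v$ for $v$ in a set $V'$ if $(\vec{v}\cdot\vec{b})_{v\in V'}$ determines $\vec{b}\in\mathbf{F}_2^I$ uniquely modulo $C_X$. *)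

(* Defs.v *)
From HB Require Import structures.
From mathcomp Require Import all_boot all_order all_algebra.

Set Implicit Arguments.
Unset Strict Implicit.
Unset Printing Implicit Defensive.

Import GRing.Theory.
Local Open Scope ring_scope.

(* Edge set of the simple closed walk c_0 - c_1 - ... - c_(k-1) - c_0. *)
Definition cycle_edges (V : finType) (c : seq V) : {set {set V}} :=
  [set [set x; next c x] | x in c].

Definition star (V : finType) (E : {set {set V}}) (v : V) : {set {set V}} :=
  [set e in E | v \in e].

(* Two edges at v are adjacent in the link of v when they lie on a common
   face. *)
Definition link_rel (V : finType) (E : {set {set V}}) (F : {set {set {set V}}})
    (v : V) : rel {set V} :=
  [rel e1 e2 | [&& e1 \in star E v, e2 \in star E v &
                   [exists f in F, (e1 \in f) && (e2 \in f)]]].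

Definition boundary_edge_of (V : finType) (F : {set {set {set V}}})
    (e : {set V}) : bool :=
  #|[set f in F | e \in f]| == 1%N.

(* A finite tiling of a surface, possibly with boundary, together with a
   declaration of some boundary edges as open (the other boundary edges are
   closed).  An edge lies on at most two faces and a face through v contains
   exactly two edges at v, so the link of v has degree at most two; its
   connectedness makes it a path or a circle, which says that the discs glued
   along the faces form a surface near v.  The surface need not be connected. *)
Record tiling (V : finType) := Tiling {
  edges : {set {set V}};
  faces : {set {set {set V}}};
  open_edges : {set {set V}};
  edges_card2 : forall e, e \in edges -> #|e| = 2%N;
  faces_sub : forall f, f \in faces -> f \subset edges;
  faces_cycle : forall f, f \in faces ->
    exists c : seq V, [/\ uniq c, 2 < size c & f = cycle_edges c]%N;
  edges_faces : forall e, e \in edges ->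
    (1 <= #|[set f in faces | e \in f]| <= 2)%N;
  vertices_covered : forall v, exists2 e, e \in edges & v \in e;
  links_connected : forall v e1 e2,
    e1 \in star edges v -> e2 \in star edges v ->
    connect (link_rel edges faces v) e1 e2;
  open_edges_sub : forall e, e \in open_edges ->
    (e \in edges) && boundary_edge_of faces e
}.

Section SurfaceCode.

Variables (V : finType) (T : tiling V).

Definition boundary_edges : {set {set V}} :=
  [set e in edges T | boundary_edge_of (faces T) e].

Definition boundary_vertices : {set V} :=
  [set v | [exists e in boundary_edges, v \in e]].

Definition open_vertices : {set V} :=
  [set v in boundary_vertices | [exists e in open_edges T, v \in e]].

Definition nonopen_edges : {set {set V}} := edges T :\: open_edges T.

Definition nonopen_vertices : {set V} := ~: open_vertices.

Definition nqubits : nat := #|nonopen_edges|.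

(* The identification of {0, ..., n-1} with the non-open edges. *)
Definition qubit (i : 'I_nqubits) : {set V} := enum_val i.

Definition vvec (v : V) : 'rV['F_2]_nqubits :=
  \row_i (if v \in qubit i then 1 else 0).

Definition fvec (f : {set {set V}}) : 'rV['F_2]_nqubits :=
  \row_i (if qubit i \in f then 1 else 0).

Definition vspan (W : {set V}) : {vspace 'rV['F_2]_nqubits} :=
  <<[seq vvec v | v <- enum W]>>%VS.

Definition fspan (G : {set {set {set V}}}) : {vspace 'rV['F_2]_nqubits} :=
  <<[seq fvec f | f <- enum G]>>%VS.

(* Z_f is Z^(fvec f) and X_v is X^(vvec v): C_X consists of the Z-type
   stabilizers, which detect X errors, and C_Z of the X-type stabilizers. *)
Definition C_X : {vspace 'rV['F_2]_nqubits} := fspan (faces T).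

Definition C_Z : {vspace 'rV['F_2]_nqubits} := vspan nonopen_vertices.

Definition coordinate (i : 'I_nqubits) (a : 'rV['F_2]_nqubits) : ('F_2)^o :=
  a 0 i.

Definition dot (c a : 'rV['F_2]_nqubits) : ('F_2)^o := \sum_i c 0 i * a 0 i.

Definition supported_on (J : {set {set V}}) : {vspace 'rV['F_2]_nqubits} :=
  (\bigcap_(i | qubit i \notin J) lker (linfun (coordinate i)))%VS.

Definition dual (C : {vspace 'rV['F_2]_nqubits}) :
    {vspace 'rV['F_2]_nqubits} :=
  (\bigcap_(c : 'rV['F_2]_nqubits | c \in C) lker (linfun (dot c)))%VS.

Fact coordinate_is_linear i : linear (coordinate i).
Proof. by move=> k a b; rewrite /coordinate !mxE. Qed.

HB.instance Definition _ i :=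
  GRing.isLinear.Build 'F_2 'rV['F_2]_nqubits ('F_2)^o _ (coordinate i)
    (coordinate_is_linear i).

Fact dot_is_linear c : linear (dot c).
Proof.
move=> k a b; rewrite /dot scaler_sumr -big_split /=.
by apply: eq_bigr => i _; rewrite !mxE mulrDr; congr (_ + _); exact: mulrCA.
Qed.

HB.instance Definition _ c :=
  GRing.isLinear.Build 'F_2 'rV['F_2]_nqubits ('F_2)^o _ (dot c)
    (dot_is_linear c).

Lemma mem_bigcapv (J : finType) (P : pred J)
    (U : J -> {vspace 'rV['F_2]_nqubits}) a :
  reflect (forall j, P j -> a \in U j) (a \in \bigcap_(j | P j) U j)%VS.
Proof.
rewrite memvE; apply: (iffP subv_bigcapP) => aU j /aU; by rewrite -memvE.
Qed.

Lemma supported_onP (J : {set {set V}}) (a : 'rV['F_2]_nqubits) :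
  reflect (forall i, qubit i \notin J -> a 0 i = 0) (a \in supported_on J).
Proof.
apply: (iffP (mem_bigcapv _ _ _)) => aJ i /aJ; rewrite memv_ker lfunE /=.
  by move/eqP.
by move=> a0; apply/eqP.
Qed.

Lemma dualP (C : {vspace 'rV['F_2]_nqubits}) (a : 'rV['F_2]_nqubits) :
  reflect (forall c, c \in C -> dot c a = 0) (a \in dual C).
Proof.
apply: (iffP (mem_bigcapv _ _ _)) => aC c /aC; rewrite memv_ker lfunE /=.
  by move/eqP.
by move=> a0; apply/eqP.
Qed.

Section Erasure.

Variable I : {set {set V}}.

(* Erasure correction for this CSS code: an X (respectively Z) error supported
   on I commutes with every Z_f (respectively X_v) iff it is a stabilizer. *)
Definition correctable : Prop :=
  (C_Z :&: supported_on I = dual C_X :&: supported_on I)%VS /\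
  (C_X :&: supported_on I = dual C_Z :&: supported_on I)%VS.

Definition unerased : {set {set V}} := nonopen_edges :\: I.

Definition unerased_vertices : {set V} :=
  [set v in nonopen_vertices | ~~ [exists e in I, v \in e]].

Definition unerased_faces : {set {set {set V}}} :=
  [set f in faces T | ~~ [exists e in I, e \in f]].

(* The outcomes (dot (fvec f) a) for f in G determine the X error X^a with a
   supported on I, modulo the X-type stabilizers. *)
Definition X_erasures_identified (G : {set {set {set V}}}) : Prop :=
  forall a b : 'rV['F_2]_nqubits,
    a \in supported_on I -> b \in supported_on I ->
    (forall f, f \in G -> dot (fvec f) a = dot (fvec f) b) ->
    a - b \in C_Z.

Definition Z_erasures_identified (W : {set V}) : Prop :=
  forall a b : 'rV['F_2]_nqubits,
    a \in supported_on I -> b \in supported_on I ->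
    (forall v, v \in W -> dot (vvec v) a = dot (vvec v) b) ->
    a - b \in C_X.

(* The qubits on which some Z_f with f in G, respectively some X_v with v in
   W, acts as a non-identity Pauli matrix. *)
Definition Z_measured_qubits (G : {set {set {set V}}}) : {set {set V}} :=
  [set qubit i | i : 'I_nqubits & [exists f in G, fvec f 0 i != 0]].

Definition X_measured_qubits (W : {set V}) : {set {set V}} :=
  [set qubit i | i : 'I_nqubits & [exists v in W, vvec v 0 i != 0]].

(* The X (respectively Z) erasures at I are identified by m measurements, those
   of Z_f for f in G (respectively X_v for v in W), which act on exactly the k
   qubits of Q. *)
Definition X_erasures_identified_by (G : {set {set {set V}}})
    (Q : {set {set V}}) (m k : nat) : Prop :=
  [/\ G \subset faces T, #|G| = m, Z_measured_qubits G = Q, #|Q| = k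
    & X_erasures_identified G].

Definition Z_erasures_identified_by (W : {set V})
    (Q : {set {set V}}) (m k : nat) : Prop :=
  [/\ W \subset nonopen_vertices, #|W| = m, X_measured_qubits W = Q, #|Q| = k
    & Z_erasures_identified W].

End Erasure.

End SurfaceCode.

(* Main.v *)
(* A generator acting trivially on I is supported off I, so it is orthogonal to
   every vector supported on I and its syndrome carries no information.  An
   error on I with vanishing syndrome on the remaining generators is therefore
   orthogonal to the whole code, and correctability makes it a stabilizer. *)

Require Import Defs.
From mathcomp Require Import all_boot all_order all_algebra.

Set Implicit Arguments.
Unset Strict Implicit.
Unset Printing Implicit Defensive.

Import GRing.Theory.
Local Open Scope ring_scope.

Section GeneratedCodes.

Variables (V : finType) (T : tiling V) (I : {set {set V}}).
(** One argument serves both kinds of generator: [x] will be [fvec T] or [vvec T], [A] will index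
    all generators of the code and [B] those that act trivially on [I]. *)
Variables (J : finType) (x : J -> 'rV['F_2]_(nqubits T)).
Variables A B : {set J}.

Local Notation span_of S := (<<[seq x j | j <- enum S]>>%VS).
Local Notation unerased_space := (supported_on T (unerased T I)).

Lemma mem_span_of (S : {set J}) j : j \in S -> x j \in span_of S.
Proof. by move=> jS; apply/memv_span/map_f; rewrite mem_enum. Qed.

Lemma span_of_subv (S : {set J}) (U : {vspace 'rV['F_2]_(nqubits T)}) :
  (forall j, j \in S -> x j \in U) -> (span_of S <= U)%VS.
Proof.
by move=> SU; apply/span_subvP => _ /mapP[j jS ->]; apply: SU; rewrite -mem_enum.
Qed.

Hypothesis sBA : B \subset A.
Hypothesis unerasedB : forall j, j \in B -> x j \in unerased_space.

Lemma span_of_unerased_subv : (span_of B <= span_of A :&: unerased_space)%VS.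
Proof.
apply: span_of_subv => j jB; rewrite memv_cap unerasedB // andbT.
exact/mem_span_of/(subsetP sBA).
Qed.

(** Each generator already lies in one of the two summands: those in [B] are supported off [I], and
    the others generate the first summand. *)
Lemma span_of_decomposition :
  (span_of A = span_of (A :\: B)%SET + (span_of A :&: unerased_space))%VS.
Proof.
apply/eqP; rewrite eqEsubv subv_add capvSl andbT; apply/andP; split.
  apply: span_of_subv => j jA; have [jB|jB] := boolP (j \in B).
    apply: (subvP (addvSr _ _)); rewrite memv_cap unerasedB // andbT.
    exact: mem_span_of.
  by apply: (subvP (addvSl _ _)); apply: mem_span_of; rewrite inE jB.
by apply: span_of_subv => j /setDP[jA _]; apply: mem_span_of.
Qed.

Lemma dotC (c a : 'rV['F_2]_(nqubits T)) : dot c a = dot a c.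
Proof. by apply: eq_bigr => i _; rewrite mulrC. Qed.

(** The supports are disjoint, so every term of the sum has a zero factor: that of [c] on [I], that
    of [a] elsewhere. *)
Lemma dot_erased_unerased (c a : 'rV['F_2]_(nqubits T)) :
  c \in unerased_space -> a \in supported_on T I -> dot c a = 0.
Proof.
move=> /supported_onP c0 /supported_onP a0; apply: big1 => i _.
have [iI|iI] := boolP (qubit i \in I); last by rewrite a0 // mulr0.
by rewrite c0 ?mul0r // inE iI.
Qed.

Lemma mem_dual_span_of (a : 'rV['F_2]_(nqubits T)) :
    a \in supported_on T I -> (forall j, j \in A :\: B -> dot (x j) a = 0) ->
  a \in dual (span_of A).
Proof.
move=> aI aAB; apply/dualP => c cA.
(* The vectors orthogonal to [a] form a subspace, so it suffices to test generators. Linearity is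
   declared for the second argument of [dot], hence the swap by [dotC]. *)
suff /subvP/(_ c cA) : (span_of A <= lker (linfun (dot a)))%VS.
  by rewrite memv_ker lfunE dotC => /eqP.
apply: span_of_subv => j jA; rewrite memv_ker lfunE /= dotC; apply/eqP.
have [jB|jB] := boolP (j \in B); last by apply: aAB; rewrite inE jB.
exact: dot_erased_unerased (unerasedB jB) aI.
Qed.

(** Two errors on [I] with equal syndromes differ by an error on [I] with zero syndrome, to which
    [mem_dual_span_of] applies. Here [C] is the code of stabilizers of the same type as the
    errors. *)
Lemma erasures_identified (C : {vspace 'rV['F_2]_(nqubits T)}) :
    (C :&: supported_on T I = dual (span_of A) :&: supported_on T I)%VS ->
  forall a b, a \in supported_on T I -> b \in supported_on T I ->
    (forall j, j \in A :\: B -> dot (x j) a = dot (x j) b) -> a - b \in C.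
Proof.
move=> CI a b aI bI ab; have abI := rpredB aI bI.
suff: a - b \in (C :&: supported_on T I)%VS by rewrite memv_cap => /andP[].
rewrite CI memv_cap abI andbT; apply: mem_dual_span_of => // j jAB.
by rewrite raddfB /= ab // subrr.
Qed.

End GeneratedCodes.

Section Incidence.

Variables (V : finType) (T : tiling V).

Lemma fvec_neq0 f i : (fvec T f 0 i != 0) = (qubit i \in f).
Proof. by rewrite mxE; case: ifP; rewrite ?oner_neq0 ?eqxx. Qed.

Lemma vvec_neq0 v i : (vvec T v 0 i != 0) = (v \in qubit i).
Proof. by rewrite mxE; case: ifP; rewrite ?oner_neq0 ?eqxx. Qed.

(** Since [qubit] enumerates the non-open edges bijectively, conditions on indices turn into
    conditions on edges. *)
Lemma qubit_image (Q : pred 'I_(nqubits T)) (P : pred {set V}) :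
    (forall i, Q i = P (qubit i)) ->
  [set qubit i | i : 'I_(nqubits T) & Q i] = [set e in nonopen_edges T | P e].
Proof.
move=> QP; apply/setP=> e; rewrite inE; apply/imsetP/andP => [[i]|[eE Pe]].
  by rewrite inE QP => Pi ->; rewrite enum_valP.
by exists (enum_rank_in eE e); rewrite ?inE ?QP /qubit enum_rankK_in.
Qed.

Lemma Z_measured_qubitsE (G : {set {set {set V}}}) :
  Z_measured_qubits T G = nonopen_edges T :&: \bigcup_(f in G) f.
Proof.
rewrite /Z_measured_qubits (@qubit_image _ (mem (\bigcup_(f in G) f))) => [|i].
  by apply/setP => e; rewrite !inE.
apply/existsP/bigcupP => [[f]|[f fG fi]]; last first.
  by exists f; rewrite fvec_neq0 fG.
by rewrite fvec_neq0 => /andP[]; exists f.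
Qed.

Lemma X_measured_qubitsE (W : {set V}) :
  X_measured_qubits T W =
  [set e in nonopen_edges T | [exists v in W, v \in e]].
Proof.
apply: (@qubit_image _ (fun e : {set V} => [exists v in W, v \in e])) => i.
by apply: eq_existsb => v; rewrite vvec_neq0.
Qed.

Variable I : {set {set V}}.

Lemma fvec_unerased f :
  f \in unerased_faces T I -> fvec T f \in supported_on T (unerased T I).
Proof.
rewrite inE => /andP[_ fI]; apply/supported_onP => i.
(* A qubit is always a non-open edge, so one outside [unerased T I] is erased; a nonzero component
   there would put an erased edge in [f]. *)
rewrite inE enum_valP andbT negbK => iI; apply/eqP.
apply: contraNT fI; rewrite fvec_neq0 => fi.
by apply/existsP; exists (qubit i); rewrite iI.
Qed.

Lemma vvec_unerased v :
  v \in unerased_vertices T I -> vvec T v \in supported_on T (unerased T I).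
Proof.
rewrite inE => /andP[_ vI]; apply/supported_onP => i.
rewrite inE enum_valP andbT negbK => iI; apply/eqP.
apply: contraNT vI; rewrite vvec_neq0 => vi.
by apply/existsP; exists (qubit i); rewrite iI.
Qed.

Lemma unerased_faces_sub : unerased_faces T I \subset faces T.
Proof. by apply/subsetP => f; rewrite inE => /andP[]. Qed.

Lemma unerased_vertices_sub : unerased_vertices T I \subset nonopen_vertices T.
Proof. by apply/subsetP => v; rewrite inE => /andP[]. Qed.

End Incidence.

Theorem proposition13 (V : finType) (T : tiling V) (I : {set {set V}})
    (hI : I \subset nonopen_edges T) :
  let F' := faces T :\: unerased_faces T I in
  let V' := nonopen_vertices T :\: unerased_vertices T I in
  let D_X := fspan T F' in
  let D_Z := vspan T V' in
  let QF := nonopen_edges T :&: \bigcup_(f in F') f in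
  let QV := [set e in nonopen_edges T | [exists v in V', v \in e]] in
  [/\ (fspan T (unerased_faces T I)
         <= C_X T :&: supported_on T (unerased T I))%VS /\
      (vspan T (unerased_vertices T I)
         <= C_Z T :&: supported_on T (unerased T I))%VS,
      (C_X T = D_X + (C_X T :&: supported_on T (unerased T I)))%VS /\
      (C_Z T = D_Z + (C_Z T :&: supported_on T (unerased T I)))%VS
    & correctable T I ->
      X_erasures_identified_by T I F' QF #|F'| #|QF| /\
      Z_erasures_identified_by T I V' QV #|V'| #|QV|].
Proof.
move=> F' V' D_X D_Z QF QV.
have sF := unerased_faces_sub T I; have sV := unerased_vertices_sub T I.
have uF := @fvec_unerased V T I; have uV := @vvec_unerased V T I.
split; [split | split | case=> corX corZ; split].
- exact: span_of_unerased_subv sF uF.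
- exact: span_of_unerased_subv sV uV.
- exact: span_of_decomposition uF.
- exact: span_of_decomposition uV.
- split=> //; first exact: subsetDl.
    exact: Z_measured_qubitsE.
  (* The roles cross: [corX] identifies [C_Z] with the dual of [C_X] on [I], so face syndromes
     determine [X] errors modulo [C_Z]. *)
  exact: erasures_identified uF _ corX.
- split=> //; first exact: subsetDl.
    exact: X_measured_qubitsE.
  exact: erasures_identified uV _ corZ.
Qed.
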